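(* Let $\beta>0$ and $\gamma\in\mathbb{R}$, and for integers $n\ge0$ let $$\mathcal{B}_n^{(\gamma,\beta)}(x)=x^nL_n^{1-2n-\gamma}(\beta/x)$$ be the generalized Bessel polynomials. If $m,n\ge0$ are integers with $\gamma<2-2\max(m,n)$, then $$\int_0^\infty\mathcal{B}_m^{(\gamma,\beta)}(x)\mathcal{B}_n^{(\gamma,\beta)}(x)\,\Omega_{m,n}(x)\,dx=\beta^{2n-2+\gamma}\frac{\Gamma(2-n-\gamma)}{\Gamma(n+1)}\delta_{m,n},\qquad \Omega_{m,n}(x)=x^{|m-n|+\gamma-3}e^{-\beta/x}.$$
   Context: $L_n^\alpha(x)=\sum_{k=0}^n\binom{n+\alpha}{n-k}\frac{(-x)^k}{k!}$ is the associated Laguerre polynomial (for arbitrary real $\alpha$, with $\binom{n+\alpha}{n-k}=\frac{(\alpha+k+1)(\alpha+k+2)\cdots(\alpha+n)}{(n-k)!}$). $\Gamma$ is the Gamma function and $\delta_{m,n}$ the Kronecker symbol. *)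

(* Defs.v *)
From mathcomp Require Import all_boot all_order all_algebra.
From mathcomp Require Import all_classical all_reals all_analysis.

Set Implicit Arguments.
Unset Strict Implicit.
Unset Printing Implicit Defensive.

Import Order.TTheory GRing.Theory Num.Theory.
Import numFieldNormedType.Exports.

Local Open Scope classical_set_scope.
Local Open Scope ring_scope.

(* binom(n + a, n - k) for a real a and k <= n:
   (a + k + 1) (a + k + 2) ... (a + n) / (n - k)! *)
Definition binom_shift (R : realType) (a : R) (n k : nat) : R :=
  (\prod_(k.+1 <= i < n.+1) (a + i%:R)) / ((n - k)`!)%:R.

Definition laguerre (R : realType) (n : nat) (a x : R) : R :=
  \sum_(k < n.+1) binom_shift a n k * (- x) ^+ k / (k`!)%:R.

(* The quotient b / x makes this the generalized Bessel polynomial for x != 0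
   only: the library convention b / 0 = 0 gives the wrong value at x = 0. *)
Definition gen_bessel (R : realType) (n : nat) (g b x : R) : R :=
  x ^+ n * laguerre n (1 - 2 * n%:R - g) (b / x).

Definition bessel_weight (R : realType) (m n : nat) (g b x : R) : R :=
  x `^ (`|m - n|%N%:R + g - 3) * expR (- b / x).

(* Euler's integral, hence the Gamma function for s > 0 only: for s <= 0 the
   integral diverges and this is a default value. *)
Definition Gamma (R : realType) (s : R) : R :=
  \int[lebesgue_measure]_(t in `]0, +oo[) (t `^ (s - 1) * expR (- t)).

(* Main.v *)
(* By symmetry let n <= m and put a = 1 - 2 m - g > -1. On ]0, +oo[ the integrand is a
   finite combination of x^(-s-1) e^(-b/x) with exponents s = a + 1 + j + k, where
   j <= m and k <= n index the coefficients of the two polynomials. The substitution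
   t = b/x gives each term the integral Gamma(s) / b^s, so everything reduces to the
   moments of the Laguerre polynomial of parameter a against t^(a+k) e^(-t), k <= m.
   Since binom_shift a m j * Gamma(a+1+j) = Gamma(a+1+m) / (m-j)!, such a moment is
   the m-th finite difference of a monic polynomial of degree k in j: it vanishes for
   k < m and is (-1)^m Gamma(a+1+m) for k = m. *)
Require Import Defs.
From mathcomp Require Import all_boot all_order all_algebra.
From mathcomp Require Import all_classical all_reals all_analysis.
From mathcomp Require Import measurable_realfun.
From mathcomp Require Import ring lra.

Import Order.TTheory GRing.Theory Num.Theory.
Import numFieldNormedType.Exports.

Local Open Scope classical_set_scope.
Local Open Scope ring_scope.

(** * Exhaustion of the half-line by compact windows *)

(** Differentiability and continuity are two-sided even at the endpoints, so the one-sided limits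
    asked for by the fundamental theorem of calculus follow at once. *)
Lemma integral_is_derive (R : realType) (F f : R -> R) (a b : R) : a < b ->
  (forall x, a <= x <= b -> is_derive x 1 F (f x)) ->
  (forall x, a <= x <= b -> {for x, continuous f}) ->
  (\int[@lebesgue_measure R]_(x in `[a, b]) (f x)%:E = (F b - F a)%:E)%E.
Proof.
move=> ab dF cf.
have cF x : a <= x <= b -> {for x, continuous F}.
  move=> xab; apply: differentiable_continuous; apply/derivable1_diffP.
  by case: (dF x xab).
have aab : a <= a <= b by rewrite lexx ltW.
have bab : a <= b <= b by rewrite lexx ltW.
rewrite EFinB; apply: continuous_FTC2 => //.
- apply: continuous_in_subspaceT => x; rewrite inE/= in_itv/=; exact: cf.
- split.
  + move=> x; rewrite in_itv/= => /andP[ax xb].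
    by case: (dF x _) => //; rewrite !ltW.
  + exact/cvg_at_right_filter/cF.
  + exact/cvg_at_left_filter/cF.
- move=> x; rewrite in_itv/= => /andP[ax xb].
  by rewrite derive1E; case: (dF x _) => //; rewrite !ltW.
Qed.

(* Windows with reciprocal endpoints: x |-> b / x maps [window 1 N] onto [window b N],
   so the substitution can be carried out on each window before passing to the limit. *)
Definition window (R : realType) (c : R) (N : nat) : set R :=
  `[c / N.+2%:R, c * N.+2%:R].

Lemma window_gt0 (R : realType) (c : R) (N : nat) (x : R) : 0 < c ->
  c / N.+2%:R <= x -> 0 < x.
Proof. by move=> c0; apply: lt_le_trans; rewrite divr_gt0 ?ltr0n. Qed.

Lemma window_lt (R : realType) (c : R) (N : nat) : 0 < c ->
  c / N.+2%:R < c * N.+2%:R.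
Proof.
move=> c0; rewrite ltr_pM2l//; apply: (@lt_trans _ _ 1).
  by rewrite invf_lt1 ?ltr0n// ltr1n.
by rewrite ltr1n.
Qed.

Lemma window_nd (R : realType) (c : R) : 0 < c ->
  nondecreasing_seq (window R c).
Proof.
move=> c0; apply/nondecreasing_seqP => N; rewrite subsetEset /window.
apply: subset_itv; rewrite bnd_simp ler_pM2l//.
  by rewrite lef_pV2 ?posrE ?ltr0n// ler_nat.
by rewrite ler_nat.
Qed.

Lemma bigcup_window (R : realType) (c : R) : 0 < c ->
  \bigcup_N window R c N = `]0, +oo[%classic.
Proof.
move=> c0; apply/seteqP; split=> x /=.
  move=> [N _]; rewrite /window/= !in_itv/= andbT => /andP[+ _].
  exact: window_gt0.
rewrite in_itv/= andbT => x0.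
(* The left endpoint needs c / x and the right one x / c to be at most [N.+2]; both quotients are
   positive, so a bound on their sum bounds each. *)
pose N := Num.truncn (c / x + x / c).
have le : c / x + x / c <= N.+2%:R.
  apply: ltW; apply: (lt_trans (truncnS_gt _)); rewrite ltr_nat.
  by rewrite ltnS.
have cx : 0 < c / x by exact: divr_gt0.
have xc : 0 < x / c by exact: divr_gt0.
exists N => //; rewrite /window/= in_itv/=; apply/andP; split.
  rewrite ler_pdivrMr ?ltr0n// mulrC -ler_pdivrMr//.
  by apply: le_trans le; rewrite lerDl ltW.
rewrite mulrC -ler_pdivrMr//.
by apply: le_trans le; rewrite lerDr ltW.
Qed.

(** Monotone convergence along the windows. The limit lives in the extended reals, so it is
    available before [eGamma] is known to be finite. *)
Lemma ge0_integral_window_cvg (R : realType) (c : R) (f : R -> R) : 0 < c ->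
  measurable_fun (`]0, +oo[%classic : set R) f -> (forall x, 0 < x -> 0 <= f x) ->
  (\int[@lebesgue_measure R]_(x in window R c N) (f x)%:E @[N --> \oo] -->
   \int[@lebesgue_measure R]_(x in `]0%R, +oo[) (f x)%:E)%E.
Proof.
move=> c0 mf f0; rewrite -(@bigcup_window R c)//.
apply: ge0_nondecreasing_set_cvg_integral.
- exact: window_nd.
- by move=> N; exact: measurable_itv.
- move=> N; apply/measurable_EFinP; apply: measurable_funS mf => //.
  by rewrite -(@bigcup_window R c)//; exact: bigcup_sup.
- by move=> N x; rewrite /window/= in_itv/= lee_fin => /andP[/window_gt0+ _] => /(_ c0)/f0.
Qed.

(** * The Gamma function: recursion and finiteness *)

(* Extended values: the recursion [eGammaS] is proved first, and finiteness is derived from it. *)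
Definition eGamma (R : realType) (s : R) : \bar R :=
  (\int[@lebesgue_measure R]_(t in `]0%R, +oo[) (t `^ (s - 1) * expR (- t))%:E)%E.

(** The derivative is arranged as s times the integrand of [eGamma R s] minus that of
    [eGamma R (s + 1)], ready for integration by parts. *)
Lemma is_derive_powR_expRN (R : realType) (s t : R) : 0 < t ->
  is_derive t 1 (fun t => t `^ s * expR (- t))
    (s * (t `^ (s - 1) * expR (- t)) - t `^ s * expR (- t)).
Proof.
move=> t0; have dp := is_derive1_powR s t0.
apply: is_derive_eq; rewrite /GRing.scale/=; ring.
Qed.

Lemma continuous_powR_expRN (R : realType) (s t : R) : 0 < t ->
  {for t, continuous (fun t => t `^ s * expR (- t))}.
Proof.
move=> t0; apply: differentiable_continuous; apply/derivable1_diffP.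
by case: (is_derive_powR_expRN R s t t0).
Qed.

Lemma measurable_powR_expRN (R : realType) (s : R) :
  measurable_fun [set: R] (fun t => t `^ s * expR (- t)).
Proof.
by apply: measurable_funM => //; apply: measurableT_comp.
Qed.

Lemma powR_expRN_ge0 (R : realType) (s t : R) : 0 <= t `^ s * expR (- t).
Proof. by rewrite mulr_ge0 ?powR_ge0 ?expR_ge0. Qed.

Lemma eGamma_ge0 (R : realType) (s : R) : (0 <= eGamma R s)%E.
Proof. by apply: integral_ge0 => t _; rewrite lee_fin powR_expRN_ge0. Qed.

Lemma Gamma_fine (R : realType) (s : R) : Gamma s = fine (eGamma R s).
Proof. by []. Qed.

Lemma cvg_natS2V (R : realType) : (N.+2%:R : R)^-1 @[N --> \oo] --> 0.
Proof. by have := @cvg_harmonic R; rewrite -cvg_shiftS. Qed.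

(** A single term of the exponential series, t^(n+1) / (n+1)! <= e^t, leaves one power of t to spare
    over t^n. *)
Lemma powR_expRN_le (R : realType) (s t : R) (n : nat) : 1 <= t -> s <= n%:R ->
  t `^ s * expR (- t) <= n.+1`!%:R * t^-1.
Proof.
move=> t1 sn; have t0 : 0 < t by exact: lt_le_trans t1.
have le1 : t `^ s <= t ^+ n by rewrite -powR_mulrn ?(ltW t0)// ler_powR.
have le2 : t ^+ n.+1 / n.+1`!%:R <= expR t.
  by apply: le_trans (expR_ge1Dxn n (ltW t0)); rewrite lerDr.
rewrite expRN ler_pdivrMr ?expR_gt0//.
apply: (le_trans le1); rewrite -mulrA [t^-1 * _]mulrC mulrA.
by rewrite ler_pdivlMr// -exprSr mulrC -ler_pdivrMr// ltr0n fact_gt0.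
Qed.

(** Boundary term of the integration by parts in [eGammaS]: exponential decay kills it at infinity,
    and [0 < s] kills it at 0. The factors 1 keep the endpoints in the form given by
    [window R 1 N]. *)
Lemma cvg_powR_expRN_window (R : realType) (s : R) : 0 < s ->
  ((1 * N.+2%:R : R) `^ s * expR (- (1 * N.+2%:R)) -
   (1 / N.+2%:R) `^ s * expR (- (1 / N.+2%:R))) @[N --> \oo] --> 0.
Proof.
move=> s0; rewrite -[X in _ --> X](subrr 0); apply: cvgB.
  pose n := (Num.truncn s).+1.
  apply: (@squeeze_cvgr _ _ _ _ (cst 0) (fun N : nat => n.+1`!%:R * (N.+2%:R : R)^-1)).
  - near=> N; rewrite powR_expRN_ge0/= mul1r; apply: powR_expRN_le.
      by rewrite ler1n.
    exact/ltW/truncnS_gt.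
  - exact: cvg_cst.
  - rewrite -[X in _ --> X](mulr0 n.+1`!%:R); apply: cvgM; first exact: cvg_cst.
    exact: cvg_natS2V.
have cvg0 : (N.+2%:R : R)^-1 `^ s @[N --> \oo] --> 0.
  have /cvg_at_rightP := powR_cvg0 s0.
  apply; split; last exact: cvg_natS2V.
  by move=> N; rewrite invr_gt0.
apply: (@squeeze_cvgr _ _ _ _ (cst 0) (fun N : nat => (N.+2%:R : R)^-1 `^ s)) => //.
- near=> N; rewrite powR_expRN_ge0/= mul1r.
  by rewrite ler_piMr ?powR_ge0// expR_le1 oppr_le0.
- exact: cvg_cst.
Unshelve. all: end_near. Qed.

Lemma integrable_window (R : realType) (f : R -> R) (c : R) (N : nat) : 0 < c ->
  (forall x, 0 < x -> {for x, continuous f}) ->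
  (@lebesgue_measure R).-integrable (window R c N) (EFin \o f).
Proof.
move=> c0 cf; rewrite /window; apply: continuous_compact_integrable.
  exact: segment_compact.
apply: continuous_in_subspaceT => x; rewrite inE/= in_itv/= => /andP[cx _].
exact/cf/(window_gt0 _ _ _ _ c0 cx).
Qed.

(** Integration by parts on each window, then passage to the limit. Each side has one integral, and
    the added boundary term is finite, so no difference of infinities can arise. *)
Lemma eGammaS (R : realType) (s : R) : 0 < s ->
  eGamma R (s + 1) = (s%:E * eGamma R s)%E.
Proof.
move=> s0.
have cvgw r := ge0_integral_window_cvg R 1 (fun t : R => t `^ (r - 1) * expR (- t))
  ltr01 (measurable_funTS (measurable_powR_expRN R (r - 1)))
  (fun t _ => powR_expRN_ge0 R (r - 1) t).
have cdiff x : 0 < x -> {for x, continuous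
    (fun t : R => s * (t `^ (s - 1) * expR (- t)) - t `^ s * expR (- t))}.
  move=> x0; apply: continuousB; last exact: continuous_powR_expRN.
  by apply: continuousM; [exact: cst_continuous|exact: continuous_powR_expRN].
have parts N :
  (s%:E * \int[@lebesgue_measure R]_(t in window R 1 N) (t `^ (s - 1) * expR (- t))%:E =
   \int[@lebesgue_measure R]_(t in window R 1 N) (t `^ (s + 1 - 1) * expR (- t))%:E +
   ((1 * N.+2%:R : R) `^ s * expR (- (1 * N.+2%:R)) -
    (1 / N.+2%:R) `^ s * expR (- (1 / N.+2%:R)))%:E)%E.
  have i1 := integrable_window _ _ _ N ltr01 (continuous_powR_expRN R (s - 1)).
  have i2 := integrable_window _ _ _ N ltr01 (continuous_powR_expRN R (s + 1 - 1)).
  have <- : (\int[@lebesgue_measure R]_(t in window R 1 N)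
      (s * (t `^ (s - 1) * expR (- t)) - t `^ s * expR (- t))%:E =
    ((1 * N.+2%:R : R) `^ s * expR (- (1 * N.+2%:R)) -
      (1 / N.+2%:R) `^ s * expR (- (1 / N.+2%:R)))%:E)%E.
    apply: (integral_is_derive R (fun t => t `^ s * expR (- t))).
    - exact: window_lt.
    - by move=> x /andP[+ _] => /(window_gt0 _ _ _ _ ltr01); exact: is_derive_powR_expRN.
    - move=> x /andP[+ _] => /(window_gt0 _ _ _ _ ltr01) x0.
      exact: cdiff.
  rewrite -integralZl//; last exact: measurable_itv.
  rewrite addrK; rewrite addrK in i2.
  rewrite -integralD//=.
  - apply: eq_integral => t _; rewrite -EFinD -EFinM; congr EFin.
    by rewrite [RHS]addrC subrK.
  - exact: measurable_itv.
  - exact: (integrable_window _ _ _ _ ltr01 cdiff).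
have lhs := cvgeZl (isT : s%:E \is a fin_num) (cvgw s).
have rhs : ((\int[@lebesgue_measure R]_(t in window R 1 N) (t `^ (s + 1 - 1) * expR (- t))%:E +
   ((1 * N.+2%:R : R) `^ s * expR (- (1 * N.+2%:R)) -
    (1 / N.+2%:R) `^ s * expR (- (1 / N.+2%:R)))%:E) @[N --> \oo] --> eGamma R (s + 1) + 0)%E.
  apply: cvgeD; first by rewrite fin_num_adde_defl.
    exact: cvgw.
  apply: cvg_EFin; [exact: nearW|exact: cvg_powR_expRN_window].
move: lhs; under eq_fun do rewrite parts.
rewrite -[LHS]adde0 => lhs.
exact: (cvg_unique _ rhs lhs).
Qed.

Lemma measurable_EFin_powR_expRN (R : realType) (D : set R) (s : R) :
  measurable_fun D (fun t => (t `^ s * expR (- t))%:E).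
Proof.
apply/measurable_EFinP; apply: measurable_funTS.
exact: measurable_powR_expRN.
Qed.

Lemma eGamma1 (R : realType) : eGamma R 1 = 1%E.
Proof.
rewrite /eGamma integral_itv_obnd_cbnd; last first.
  exact: measurable_EFin_powR_expRN.
under eq_integral do rewrite subrr powRr0 mul1r.
have dE (x : R) : is_derive x 1 (fun t => - expR (- t)) (expR (- x)).
  have d1 : is_derive x 1 (fun t : R => expR (- t)) (expR (- x) * -1).
    by apply: is_derive_eq.
  by apply: (is_derive_eq (is_deriveN d1)); rewrite mulrN1 opprK.
have cE : continuous (fun t : R => expR (- t)).
  by move=> x; apply: continuous_comp; [exact: continuousN|exact: continuous_expR].
rewrite (@ge0_continuous_FTC2y _ _ (fun t => - expR (- t)) 0 0).
- by rewrite oppr0 expR0 EFinN oppeK add0e.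
- by move=> x _; exact: expR_ge0.
- exact: continuous_subspaceT.
- by rewrite -[X in _ --> X]oppr0; apply: cvgN; exact: cvgr_expR.
- by move=> x _; case: (dE x).
- apply: cvg_at_right_filter; apply: cvgN; exact: (cE 0).
- by move=> x _; rewrite derive1E; case: (dE x).
Qed.

Lemma eGamma_natS (R : realType) (n : nat) : eGamma R n.+1%:R = (n`!%:R)%:E.
Proof.
elim: n => [|n ih]; first by rewrite eGamma1 fact0.
by rewrite -[n.+2]addn1 natrD eGammaS// ih -EFinM -natrM -factS.
Qed.

Lemma eGamma_lty (R : realType) (s : R) : 0 < s -> (eGamma R s < +oo)%E.
Proof.
(* By the recursion it suffices to bound eGamma (s + 1), and t^s <= t^n + 1 for n > s. *)
move=> s0; suff : (eGamma R (s + 1) < +oo)%E.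
  rewrite eGammaS//; have := eGamma_ge0 R s.
  by case: (eGamma R s) => [r| |]//=; rewrite ?ltry// gt0_muley.
pose n := (Num.truncn s).+1.
apply: (@le_lt_trans _ _ (eGamma R n.+1%:R + eGamma R 1)%E); last first.
  by rewrite !eGamma_natS eGamma1 -EFinD ltry.
rewrite /eGamma -ge0_integralD//=; first last.
- exact: measurable_EFin_powR_expRN.
- by move=> x _; rewrite lee_fin powR_expRN_ge0.
- exact: measurable_EFin_powR_expRN.
- by move=> x _; rewrite lee_fin powR_expRN_ge0.
apply: ge0_le_integral => //=.
- by move=> x _; rewrite lee_fin powR_expRN_ge0.
- exact: measurable_EFin_powR_expRN.
- apply: emeasurable_funD;
    exact: measurable_EFin_powR_expRN.
move=> x; rewrite in_itv/= andbT => x0.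
rewrite -EFinD lee_fin -mulrDl ler_pM2r ?expR_gt0// addrK subrr powRr0.
have [x1|/ltW x1] := leP 1 x.
  apply: ler_wpDr => //; rewrite ler_powR// -natr1 addrK.
  exact/ltW/truncnS_gt.
apply: ler_wpDl; first exact: powR_ge0.
rewrite -[leRHS](powRr0 x); apply: ger_powR; last exact: ltW.
by rewrite x0.
Qed.

Lemma EFin_Gamma (R : realType) (s : R) : 0 < s -> (Gamma s)%:E = eGamma R s.
Proof.
by move=> s0; rewrite Gamma_fine fineK// ge0_fin_numE ?eGamma_lty// eGamma_ge0.
Qed.

Lemma GammaS (R : realType) (s : R) : 0 < s -> Gamma (s + 1) = s * Gamma s.
Proof.
by move=> s0; rewrite [LHS]Gamma_fine eGammaS// -EFin_Gamma.
Qed.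

Lemma Gamma_natD1 (R : realType) (n : nat) : Gamma (n%:R + 1 : R) = n`!%:R.
Proof. by rewrite Gamma_fine natr1 eGamma_natS. Qed.

(** * The substitution t = b / x *)

Lemma is_derive_divr (R : realType) (b x : R) : 0 < x ->
  is_derive x 1 (fun t => b / t) (- (b / x ^+ 2)).
Proof.
move=> x0; have dV := @is_deriveV R id x 1 1 (lt0r_neq0 x0) (is_derive_id x 1).
have d := @is_deriveZ _ _ _ (fun t : R => t^-1) b x 1 _ dV.
apply: (is_derive_eq d); rewrite /GRing.scale/=; ring.
Qed.

Lemma continuous_divr (R : realType) (b x : R) : 0 < x ->
  {for x, continuous (fun t : R => b / t)}.
Proof.
move=> x0; apply: differentiable_continuous; apply/derivable1_diffP.
by case: (is_derive_divr R b x x0).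
Qed.

Lemma derive1_divr (R : realType) (b x : R) : 0 < x ->
  (fun t => b / t)^`()%classic x = - (b / x ^+ 2).
Proof. by move=> x0; rewrite derive1E; case: (is_derive_divr R b x x0). Qed.

Lemma continuous_derive1_divr (R : realType) (b x : R) : 0 < x ->
  {for x, continuous (fun t : R => b / t)^`()%classic}.
Proof.
move=> x0; rewrite /prop_for /continuous_at derive1_divr//.
have c : - (b / t ^+ 2) @[t --> x] --> - (b / x ^+ 2).
  apply: cvgN; apply: cvgM; first exact: cvg_cst.
  apply: cvgV; first by rewrite expf_neq0// gt_eqF.
  exact: exprn_continuous.
(* The formula for the derivative is available at positive points only, and these form a
   neighbourhood of [x]. *)
apply: cvg_trans c; apply: near_eq_cvg; near=> t; rewrite derive1_divr//.
by near: t; exact: lt_nbhsr.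
Unshelve. all: end_near. Qed.

(** Up to orientation, t = b / x turns t^(s-1) e^(-t) dt into b^s x^(-s-1) e^(-b/x) dx. The change
    of variables is made between corresponding windows, and monotone convergence gives the limit on
    both sides. *)
Lemma eGamma_inv_subst (R : realType) (b s : R) : 0 < b ->
  eGamma R s = (\int[@lebesgue_measure R]_(x in `]0%R, +oo[)
    (b `^ s * (x `^ (- s - 1) * expR (- b / x)))%:E)%E.
Proof.
move=> b0.
pose h (x : R) := b `^ s * (x `^ (- s - 1) * expR (- b / x)).
have h0 x : 0 <= h x by rewrite !mulr_ge0// ?powR_ge0 ?expR_ge0.
have mh : measurable_fun (`]0, +oo[%classic : set R) h.
  apply: measurable_funM => //; apply: measurable_funM.
    exact: measurable_funTS.
  apply: measurableT_comp => //; apply: open_continuous_measurable_fun.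
    exact: interval_open.
  move=> x; rewrite inE/= in_itv/= andbT => x0.
  exact: continuous_divr.
have cvgG := ge0_integral_window_cvg R b (fun t : R => t `^ (s - 1) * expR (- t))
  b0 (measurable_funTS (measurable_powR_expRN R (s - 1)))
  (fun t _ => powR_expRN_ge0 R (s - 1) t).
have cvgh := ge0_integral_window_cvg R 1 h ltr01 mh (fun x _ => h0 x).
suff E : (fun N => \int[@lebesgue_measure R]_(t in window R b N)
      (t `^ (s - 1) * expR (- t))%:E)%E =
    (fun N => \int[@lebesgue_measure R]_(x in window R 1 N) (h x)%:E)%E.
  by move: cvgG; rewrite E => cvgG; exact: (cvg_unique _ cvgG cvgh).
apply/funext => N.
have N0 : 0 < 1 / N.+2%:R :> R by rewrite divr_gt0 ?ltr0n.
(* The map is decreasing, so the endpoints of [window R 1 N] appear in swapped order. *)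
have -> : window R b N = `[b / (1 * N.+2%:R), b / (1 / N.+2%:R)]%classic.
  by rewrite /window !mul1r invrK.
rewrite (@integration_by_substitution_decreasing R (fun x => b / x)).
- apply: eq_integral => x; rewrite inE/window/= in_itv/= => /andP[Nx _].
  have x0 : 0 < x by exact: lt_le_trans Nx.
  rewrite !fctE derive1_divr// opprK /h; congr EFin.
  (* [bE] and [xE] release the factors 1 / b and x^2 that cancel the Jacobian b / x^2. *)
  have bE : b `^ (s - 1) = b `^ s / b.
    by rewrite powRB ?(gt_eqF b0) ?implybT// powRr1// ltW.
  have xE : x^-1 `^ (s - 1) = x `^ (- s - 1) * x ^+ 2.
    rewrite -[x^-1]powR_inv1 ?(ltW x0)// -powRrM.
    rewrite -[x ^+ 2]powR_mulrn ?(ltW x0)// -powRD ?(gt_eqF x0) ?implybT//.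
    by congr (_ `^ _); ring.
  rewrite powRM ?invr_ge0 ?ltW// bE xE mulNr; field.
  by rewrite !gt_eqF.
- exact/ltW/window_lt.
- move=> x y; rewrite !in_itv/= => /andP[Nx _] /andP[Ny _] xy.
  have x0 : 0 < x by exact: lt_le_trans Nx.
  have y0 : 0 < y by exact: lt_le_trans Ny.
  by rewrite ltr_pM2l// ltf_pV2.
- move=> x; rewrite in_itv/= => /andP[Nx _].
  by apply: continuous_derive1_divr; exact: lt_trans Nx.
- apply/cvg_ex; eexists; apply: cvg_at_right_filter.
  exact: continuous_derive1_divr.
- apply/cvg_ex; eexists; apply: cvg_at_left_filter.
  apply: continuous_derive1_divr.
  by rewrite mul1r ltr0n.
- split.
  + move=> x; rewrite in_itv/= => /andP[Nx _].
    by case: (is_derive_divr R b x (lt_trans N0 Nx)).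
  + exact/cvg_at_right_filter/continuous_divr.
  + by apply/cvg_at_left_filter/continuous_divr; rewrite mul1r ltr0n.
- apply: continuous_in_subspaceT => x; rewrite inE/= in_itv/= => /andP[Nx _].
  apply: continuous_powR_expRN; apply: lt_le_trans Nx.
  by rewrite divr_gt0// mul1r ltr0n.
Qed.

(** Integrability is carried along with the value because the combinations formed next have signed
    coefficients. *)
Lemma inv_gamma_moment (R : realType) (b s : R) : 0 < b -> 0 < s ->
  (@lebesgue_measure R).-integrable `]0, +oo[
    (EFin \o (fun x => x `^ (- s - 1) * expR (- b / x))) /\
  (\int[@lebesgue_measure R]_(x in `]0%R, +oo[)
    (x `^ (- s - 1) * expR (- b / x))%:E = (Gamma s / b `^ s)%:E)%E.
Proof.
move=> b0 s0; pose h (x : R) := x `^ (- s - 1) * expR (- b / x).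
have h0 x : 0 <= h x by rewrite mulr_ge0// ?powR_ge0 ?expR_ge0.
have mh : measurable_fun (`]0, +oo[%classic : set R) h.
  apply: measurable_funM; first exact: measurable_funTS.
  apply: measurableT_comp => //; apply: open_continuous_measurable_fun.
    exact: interval_open.
  move=> x; rewrite inE/= in_itv/= andbT => x0.
  exact: continuous_divr.
have E : (\int[@lebesgue_measure R]_(x in `]0%R, +oo[) (h x)%:E =
    (Gamma s / b `^ s)%:E)%E.
  have bs0 : 0 < b `^ s by exact: powR_gt0.
  have := eGamma_inv_subst R b s b0; rewrite -EFin_Gamma//.
  under eq_integral do rewrite EFinM.
  rewrite ge0_integralZl//; last 3 first.
  - exact/measurable_EFinP.
  - by move=> x _; rewrite lee_fin h0.
  - by rewrite lee_fin ltW.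
  rewrite mulrC EFinM => ->.
  by rewrite muleA -EFinM mulVf ?gt_eqF// mul1e.
split => //; apply/integrableP; split; first exact/measurable_EFinP.
suff -> : (\int[@lebesgue_measure R]_(x in `]0%R, +oo[) `|(EFin \o h) x| =
  \int[@lebesgue_measure R]_(x in `]0%R, +oo[) (h x)%:E)%E by rewrite E ltry.
by apply: eq_integral => x _; rewrite /= ger0_norm.
Qed.

(** A general [finType] of indices allows pairs, as needed for a product of two polynomials. *)
Lemma inv_gamma_moment_sum (R : realType) (I : finType) (b : R) (s a : I -> R)
    (f : R -> R) : 0 < b -> (forall i, 0 < s i) ->
  (forall x, 0 < x ->
     f x = \sum_i a i * (x `^ (- s i - 1) * expR (- b / x))) ->
  (@lebesgue_measure R).-integrable `]0, +oo[ (EFin \o f) /\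
  (\int[@lebesgue_measure R]_(x in `]0%R, +oo[) (f x)%:E =
     (\sum_i a i * (Gamma (s i) / b `^ s i))%:E)%E.
Proof.
move=> b0 s0 fE.
pose h i (x : R) := (x `^ (- s i - 1) * expR (- b / x))%:E.
have ih i : (@lebesgue_measure R).-integrable `]0, +oo[ (fun x => (a i)%:E * h i x)%E.
  by apply: integrableZl => //; case: (inv_gamma_moment R b (s i) b0 (s0 i)).
have fE' : {in `]0, +oo[%classic, EFin \o f =1 (fun x => \sum_i ((a i)%:E * h i x))%E}.
  move=> x; rewrite inE/= in_itv/= andbT => x0.
  by rewrite fE// -sumEFin.
split.
  have : (@lebesgue_measure R).-integrable `]0, +oo[
      (fun x => \sum_i ((a i)%:E * h i x))%E by exact: integrable_sum.
  by apply: eq_integrable => // x xD; rewrite fE'.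
have -> : (\int[@lebesgue_measure R]_(x in `]0%R, +oo[) (f x)%:E =
    \int[@lebesgue_measure R]_(x in `]0%R, +oo[) \sum_i ((a i)%:E * h i x))%E.
  by apply: eq_integral => x xD; rewrite -fE'.
rewrite integral_sum// -sumEFin; apply: eq_bigr => i _.
have [ii iE] := inv_gamma_moment R b (s i) b0 (s0 i).
by rewrite integralZl// iE EFinM.
Qed.

(** * Rising factorials and finite differences *)

(** The Pochhammer symbol, a monic polynomial of degree k in y whose differences are again of the
    same kind. *)
Definition rising (R : pzRingType) (k : nat) (y : R) : R :=
  \prod_(i < k) (y + i%:R).

Lemma risingSl (R : pzRingType) (k : nat) (y : R) :
  rising R k.+1 y = y * rising R k (y + 1).
Proof.
rewrite /rising big_ord_recl addr0; congr (_ * _).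
by apply: eq_bigr => i _; rewrite lift0 -addrA nat1r.
Qed.

Lemma risingSr (R : pzRingType) (k : nat) (y : R) :
  rising R k.+1 y = rising R k y * (y + k%:R).
Proof. by rewrite /rising big_ord_recr. Qed.

(** Both products share the factors y + 1, ..., y + k; the remaining ones, y and y + k + 1, differ
    by a constant. *)
Lemma rising_diff (R : comPzRingType) (k : nat) (y : R) :
  rising R k.+1 y - rising R k.+1 (y + 1) = - (k.+1%:R * rising R k (y + 1)).
Proof. by rewrite risingSl risingSr -natr1; ring. Qed.

(** Pascal's rule: a difference of order m + 1 is a difference of order m of first differences. *)
Lemma sum_signed_binS (R : comPzRingType) (m : nat) (f : nat -> R) :
  \sum_(j < m.+2) (-1) ^+ j * 'C(m.+1, j)%:R * f j =
  \sum_(j < m.+1) (-1) ^+ j * 'C(m, j)%:R * (f j - f j.+1).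
Proof.
rewrite big_ord_recl.
under eq_bigr do rewrite lift0 binS natrD mulrDr mulrDl.
rewrite big_split/= bin0 addrA.
under [in RHS]eq_bigr do rewrite mulrBr.
rewrite sumrB; congr (_ + _); last first.
  by rewrite -sumrN; apply: eq_bigr => j _; rewrite exprS; ring.
(* The top term carries ['C(m, m.+1)], which is zero. *)
rewrite big_ord_recr/= bin_small// mulr0 mul0r addr0.
by rewrite [in RHS]big_ord_recl/= bin0.
Qed.

(** Each differencing lowers k by one, shifts y by 1 and yields a factor -k. For k = m these factors
    multiply to (-1)^m m!; for k < m a constant is reached early and its difference vanishes. *)
Lemma sum_signed_bin_rising (R : comPzRingType) (m k : nat) (y : R) : (k <= m)%N ->
  \sum_(j < m.+1) (-1) ^+ j * 'C(m, j)%:R * rising R k (y + j%:R) =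
  (-1) ^+ m * m`!%:R * (k == m)%:R.
Proof.
elim: m k y => [|m ih] k y.
  rewrite leqn0 => /eqP->; rewrite big_ord_recl big_ord0 /rising big_ord0.
  by rewrite bin0 fact0 eqxx !mulr1 addr0.
move=> km; rewrite (sum_signed_binS R m (fun j => rising R k (y + j%:R))).
case: k km => [_|k km].
  rewrite mulr0 big1// => j _.
  by rewrite /rising !big_ord0 subrr mulr0.
under eq_bigr => j _.
  rewrite -[j.+1%:R]natr1 addrA rising_diff -addrA [j%:R + 1]addrC addrA.
  rewrite mulrN mulrCA.
  over.
rewrite sumrN -mulr_sumr ih// eqSS factS natrM exprS.
have [->|_] := eqVneq k m; last by rewrite !mulr0 oppr0.
ring.
Qed.

(** * Moments of the Laguerre polynomials *)

Lemma Gamma_rising (R : realType) (k : nat) (y : R) : 0 < y ->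
  Gamma (y + k%:R) = rising R k y * Gamma y.
Proof.
move=> y0; elim: k => [|k ih]; first by rewrite addr0 /rising big_ord0 mul1r.
by rewrite -natr1 addrA GammaS ?ltr_wpDr// ih risingSr; ring.
Qed.

Lemma binom_shift_rising (R : realType) (a : R) (m j : nat) :
  binom_shift a m j = rising R (m - j) (a + 1 + j%:R) / (m - j)`!%:R.
Proof.
rewrite /binom_shift; congr (_ / _).
rewrite -(add0n j.+1) big_addn subSS big_mkord; apply: eq_bigr => i _.
by rewrite natrD -natr1; ring.
Qed.

(** The sum is the integral of L_m^a(t) t^(a+k) e^(-t) over t > 0, taken coefficient by
    coefficient. *)
Lemma laguerre_moment (R : realType) (a : R) (m k : nat) : -1 < a -> (k <= m)%N ->
  \sum_(j < m.+1) binom_shift a m j * (-1) ^+ j / j`!%:R * Gamma (a + 1 + j%:R + k%:R) =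
  (-1) ^+ m * Gamma (a + 1 + m%:R) * (k == m)%:R.
Proof.
move=> a1 km; have a0 : 0 < a + 1 by rewrite -ltrBlDr sub0r.
have fact_neq0 n : n`!%:R != 0 :> R by rewrite pnatr_eq0 -lt0n fact_gt0.
(* The rising factorial inside [binom_shift] completes Gamma(a+1+j) to Gamma(a+1+m), and 1 / ((m-j)!
   j!) is the binomial coefficient over m!. *)
transitivity (Gamma (a + 1 + m%:R) / m`!%:R *
    \sum_(j < m.+1) (-1) ^+ j * 'C(m, j)%:R * rising R k (a + 1 + j%:R)).
  rewrite mulr_sumr; apply: eq_bigr => j _.
  have jm : (j <= m)%N by rewrite -ltnS.
  have aj0 : 0 < a + 1 + j%:R by rewrite ltr_wpDr.
  rewrite binom_shift_rising (Gamma_rising R k (a + 1 + j%:R))//.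
  have -> : a + 1 + m%:R = a + 1 + j%:R + (m - j)%:R.
    by rewrite -[RHS]addrA -natrD subnKC.
  rewrite (Gamma_rising R (m - j) (a + 1 + j%:R))// -(bin_fact jm) !natrM; field.
  by rewrite !fact_neq0/= pnatr_eq0 -lt0n bin_gt0 jm.
rewrite sum_signed_bin_rising//; field.
exact: fact_neq0.
Qed.

(** * Orthogonality of the generalized Bessel polynomials *)

(** Coefficient of y^k in L_n^(1-2n-g)(y), with the sign of (-y)^k included. *)
Definition bessel_coef (R : realType) (n : nat) (g : R) (k : nat) : R :=
  binom_shift (1 - 2 * n%:R - g) n k * (-1) ^+ k / k`!%:R.

(** Real exponents let these powers merge with the real power in the weight. *)
Lemma gen_besselE (R : realType) (n : nat) (g b x : R) : 0 < x ->
  gen_bessel n g b x =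
  \sum_(k < n.+1) bessel_coef R n g k * b ^+ k * x `^ (n%:R - k%:R).
Proof.
move=> x0; rewrite /gen_bessel /laguerre mulr_sumr; apply: eq_bigr => k _.
have kn : (k <= n)%N by rewrite -ltnS.
have -> : n%:R - k%:R = (n - k)%:R :> R by rewrite natrB.
rewrite powR_mulrn ?ltW// -{1}(subnK kn) exprD exprNn /bessel_coef.
rewrite expr_div_n; field.
by rewrite expf_neq0 ?gt_eqF// pnatr_eq0 -lt0n fact_gt0.
Qed.

(** For n <= m the factor x^(m-n) of the weight removes n from the total exponent of x. What remains
    fits the Laguerre parameter a of the index m, while the other polynomial only supplies powers k
    <= n <= m. *)
Lemma gen_bessel_orthogonality (R : realType) (b g : R) (m n : nat) :
  0 < b -> (n <= m)%N -> g < 2 - 2 * m%:R ->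
  let f x := gen_bessel m g b x * gen_bessel n g b x * bessel_weight m n g b x in
  (@lebesgue_measure R).-integrable `]0, +oo[ (EFin \o f) /\
  (\int[@lebesgue_measure R]_(x in `]0%R, +oo[) (f x)%:E =
    (b `^ (2 * m%:R - 2 + g) * (Gamma (2 - m%:R - g) / m`!%:R) * (m == n)%:R)%:E)%E.
Proof.
move=> b0 nm gm f; pose a : R := 1 - 2 * m%:R - g.
have a1 : -1 < a by rewrite /a; lra.
have a10 : 0 < a + 1 by lra.
pose s (p : 'I_m.+1 * 'I_n.+1) : R := a + 1 + p.1%:R + p.2%:R.
pose c (p : 'I_m.+1 * 'I_n.+1) : R :=
  bessel_coef R m g p.1 * b ^+ p.1 * (bessel_coef R n g p.2 * b ^+ p.2).
have s0 p : 0 < s p.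
  by rewrite /s -addrA (ltr_wpDr _ a10)// addr_ge0.
have fE x : 0 < x ->
    f x = \sum_p c p * (x `^ (- s p - 1) * expR (- b / x)).
  move=> x0; rewrite /f !gen_besselE// mulr_suml.
  under eq_bigr do rewrite mulr_sumr.
  rewrite pair_bigA/= mulr_suml; apply: eq_bigr => -[j k] _ /=.
  rewrite /bessel_weight distnEl// natrB//.
  have -> : - s (j, k) - 1 =
      (m%:R - j%:R) + (n%:R - k%:R) + (m%:R - n%:R + g - 3).
    by rewrite /s /a/=; ring.
  by rewrite !(@powRD _ x) ?(gt_eqF x0) ?implybT// /c/=; ring.
have [If E] := inv_gamma_moment_sum R _ b s c f b0 s0 fE.
split => //; rewrite E; congr EFin.
(* The powers b^j and b^k cancel against those in b^s; summing over j first, at fixed k, produces a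
   Laguerre moment. *)
transitivity (b `^ (- (a + 1)) * \sum_(k < n.+1) bessel_coef R n g k *
    ((-1) ^+ m * Gamma (a + 1 + m%:R) * (k == m :> nat)%:R)).
  rewrite mulr_sumr.
  under [RHS]eq_bigr => k _.
    have km : (k <= m)%N by rewrite (leq_trans _ nm)// -ltnS.
    rewrite -laguerre_moment// !mulr_sumr; over.
  rewrite exchange_big pair_bigA/=; apply: eq_bigr => -[j k] _ /=.
  have -> : b `^ s (j, k) = b `^ (a + 1) * b ^+ j * b ^+ k.
    by rewrite -!powR_mulrn ?(ltW b0)// -!powRD ?(gt_eqF b0) ?implybT//.
  rewrite powRN /c /s/= /bessel_coef -/a; field.
  by rewrite !expf_neq0 ?gt_eqF ?powR_gt0// !pnatr_eq0 -!lt0n !fact_gt0.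
rewrite (_ : - (a + 1) = 2 * m%:R - 2 + g); last by rewrite /a; ring.
rewrite (_ : a + 1 + m%:R = 2 - m%:R - g); last by rewrite /a; ring.
rewrite -!mulrA; congr (_ * _).
(* If n < m, no index k <= n equals m, so every moment in the sum vanishes. *)
have [nE|mn] := eqVneq m n; last first.
  rewrite !mulr0 big1// => k _; rewrite (_ : (k == m :> nat) = false) ?mulr0//.
  apply/negbTE; rewrite neq_ltn (leq_ltn_trans _ (_ : n < m)%N)//.
    by rewrite -ltnS.
  by rewrite ltn_neqAle eq_sym mn.
clear E If fE s0 c s f; subst n.
(* For n = m only k = m survives; its coefficient is (-1)^m / m!, whose sign cancels that of the
   moment. *)
rewrite big_ord_recr/= eqxx big1 ?add0r; last first.
  by move=> k _; rewrite ltn_eqF// !mulr0.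
rewrite /bessel_coef /binom_shift big_geq// subnn fact0 divr1 mul1r.
by rewrite !mulr1 mulrACA -exprD addnn -signr_odd odd_double expr0 mul1r mulrC.
Qed.

Theorem mainTheorem11 (R : realType) (b g : R) (m n : nat)
    (b_gt0 : 0 < b) (g_lt : g < 2 - 2 * (maxn m n)%:R) :
  let f : R -> R := fun x =>
    gen_bessel m g b x * gen_bessel n g b x * bessel_weight m n g b x in
  (@lebesgue_measure R).-integrable `]0, +oo[ (EFin \o f) /\
  (\int[@lebesgue_measure R]_(x in `]0%R, +oo[) (f x)%:E)%E =
    (b `^ (2 * n%:R - 2 + g) * (Gamma (2 - n%:R - g) / Gamma (n%:R + 1))
      * (m == n)%:R)%:E.
Proof.
have [nm|/ltnW mn] := leqP n m.
  rewrite (maxn_idPl nm) in g_lt.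
  have [If E] := gen_bessel_orthogonality R b g m n b_gt0 nm g_lt.
  move=> f; split => //; rewrite E Gamma_natD1.
  (* The value obtained is in terms of m, the stated one in terms of n: they agree for m = n and
     both vanish otherwise. *)
  by have [->|_] := eqVneq m n; rewrite ?mulr0.
rewrite (maxn_idPr mn) in g_lt.
have [If E] := gen_bessel_orthogonality R b g n m b_gt0 mn g_lt.
move=> f; rewrite [m == n]eq_sym.
have fE : f = fun x => gen_bessel n g b x * gen_bessel m g b x * bessel_weight n m g b x.
  by apply/funext => x; rewrite /f /bessel_weight distnC [gen_bessel m _ _ _ * _]mulrC.
by rewrite fE; split => //; rewrite E Gamma_natD1.
Qed.
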